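(* Let $n_1\le n$ and $m$ be positive integers, $\mathbf n=(n_1,n)$, and let $C_{1,1}(\mathbf n,m)$ denote the number of simple digraphs on $[n]$ with $m$ arcs such that every vertex has in-degree at least $1$, every vertex in $[n_1]$ has out-degree at least $1$, and every vertex $j>n_1$ has out-degree $0$. Let $C^0_{1,1}(\mathbf n,m)$ denote the number of those digraphs that have no isolated cycles. Suppose $n_1=\Theta(n)$, $r:=m-n\to\infty$, $m=O(n)$, and $r_1:=m-n_1=O(r)$. Then $$ C^0_{1,1}(\mathbf n,m)=O\!\left(\frac{r}{n}\,C_{1,1}(\mathbf n,m)\right), $$ with the implied constant uniform over all parameters.
   Context: A simple digraph on $[n]$ has no loops and at most one arc $i\to j$ for each ordered pair $i\neq j$. An isolated cycle of a digraph is a set of vertices $C$ such that the subdigraph induced by $C$ is a directed cycle and there are no arcs between $C$ and its complement (in either direction). *)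

(* Defs.v *)
From mathcomp Require Import all_boot.

Set Implicit Arguments.
Unset Strict Implicit.
Unset Printing Implicit Defensive.

Section Digraphs.
Variable T : finType.

(* A digraph on T is its set of arcs, the pair (x, y) being the arc x -> y. *)
Definition digraph := {set T * T}.

Implicit Types (E : digraph) (C : {set T}) (x : T).

Definition simple_digraph E : bool := [forall x, (x, x) \notin E].

Definition indeg E x : nat := #|[set y | (y, x) \in E]|.
Definition outdeg E x : nat := #|[set y | (x, y) \in E]|.

Definition induced E C : digraph := [set a in E | (a.1 \in C) && (a.2 \in C)].

(* The arcs s_0 -> s_1 -> ... -> s_(k-1) -> s_0, with s an enumeration of C.
   Cycles have length at least 2, since digraphs here have no loops; a pair of
   opposite arcs is a cycle of length 2. *)
Definition directed_cycle E C : bool :=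
  (1 < #|C|) &&
  [exists s : #|C|.-tuple T,
    [&& uniq s, [set x in s] == C & E == [set (x, next s x) | x in C]]].

Definition isolated_cycle E C : bool :=
  directed_cycle (induced E C) C &&
  [forall x in C, forall y in ~: C, ((x, y) \notin E) && ((y, x) \notin E)].

End Digraphs.

(* The vertex set [n] is 'I_n, numbered from 0: [n1] is the set of i < n1. *)
Definition digraphs11 (n1 n m : nat) : {set digraph 'I_n} :=
  [set E : digraph 'I_n |
    [&& simple_digraph E, #|E| == m,
        [forall i, 0 < indeg E i],
        [forall i : 'I_n, (i < n1) ==> (0 < outdeg E i)] &
        [forall i : 'I_n, (n1 <= i) ==> (outdeg E i == 0)]]].

Definition C11 (n1 n m : nat) : nat := #|digraphs11 n1 n m|.

Definition C011 (n1 n m : nat) : nat :=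
  #|[set E in digraphs11 n1 n m | ~~ [exists C, isolated_cycle E C]]|.

(* Main.v *)
(* Call a vertex thin if its in- and out-degree are both 1; all but O(r) vertices
   are thin. In a digraph without isolated cycles, following arcs from a thin
   vertex v leads through a tail of thin vertices to a non-thin vertex w. Redirect
   v to w and rearrange the tail, of length l >= 2, into isolated cycles by an
   arbitrary derangement. This gives at least l!/3 digraphs with the same degrees
   from each pair (D, v), of which there are n - O(r) for each D. Conversely, an
   image determines the vertex set of the tail (the thin vertices from which no
   non-thin vertex is reachable), so it comes from at most k l! pairs, where k = O(r)
   is the number of thin vertices followed by a non-thin one. Hence
   (n - O(r)) C^0 <= 3 k C. *)
Require Import Defs.
From mathcomp Require Import all_boot all_order all_algebra all_fingroup.
From mathcomp Require Import reals zify lra.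

Set Implicit Arguments.
Unset Strict Implicit.
Unset Printing Implicit Defensive.

Import Order.TTheory GRing.Theory Num.Theory.

(** * A lower bound for the number of derangements *)

(** Truncated inclusion-exclusion for [x] fixed points, 1 - x + 'C(x, 2) - 'C(x, 3) <= [x = 0], with
    the negative terms moved across to stay in the naturals. *)
Lemma bin2_le_bin3 x : 1 + 'C(x, 2) <= (x == 0) + x + 'C(x, 3).
Proof.
have le_bin2 y : y <= 1 + 'C(y, 2).
  by elim: y => [//|y IHy]; rewrite binS bin1; lia.
case: x => [|[|[|x]]] //; elim: x => [//|x IHx].
by rewrite binS bin1 (binS x.+3 2); have := le_bin2 x.+3; lia.
Qed.

Section Derangements.
Variable T : finType.
Implicit Types (S A : {set T}) (s : {perm T}).

Definition derangements S : {set {perm T}} :=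
  [set s | perm_on S s & [forall x in S, s x != x]].

Definition fixpts S s := [set x in S | s x == x].

(** Both sides count pairs of a permutation and a [j]-set [A] of its fixed points in [S]: the
    permutations fixing [A] pointwise are those of [S :\: A]. *)
Lemma sum_bin_fixpts S j :
  \sum_(s | perm_on S s) 'C(#|fixpts S s|, j) = 'C(#|S|, j) * (#|S| - j)`!.
Proof.
under eq_bigr => s _ do rewrite -cards_draws -sum1dep_card big_mkcond.
rewrite exchange_big /= -cards_draws -sum1dep_card big_distrl /=.
rewrite [RHS]big_mkcond; apply: eq_bigr => A _.
case: ifPn => [/andP[sAS /eqP cA]|nAS]; last first.
  rewrite big1 // => s _; case: ifPn => // /andP[sAF cA].
  case/negP: nAS; rewrite cA andbT; apply: subset_trans sAF _.
  by apply/subsetP => x; rewrite inE => /andP[].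
rewrite mul1n -cA -(setIidPr sAS) -cardsD (setIidPr sAS) -card_perm -[RHS]sum1_card.
rewrite -big_mkcondr; apply: eq_bigl => s; rewrite eqxx andbT -[RHS]topredE /=.
apply/andP/subsetP => [[/subsetP Ss /subsetP AF] x sx|H].
  rewrite inE Ss // andbT; apply/negP => /AF; rewrite inE => /andP[_].
  by move=> fx; rewrite inE fx in sx.
split; apply/subsetP => x; first by move/H; rewrite inE => /andP[].
move=> xA; rewrite inE (subsetP sAS) //=; apply: contraTT xA => /(H x).
by rewrite inE => /andP[].
Qed.

Lemma derangement_out S s x : s \in derangements S -> x \notin S -> s x = x.
Proof. by rewrite inE => /andP[/out_perm H _]; exact: H. Qed.

(* Bonferroni's inequality truncated at triples of fixed points: the fraction of
   derangements is at least 1 - 1 + 1/2 - 1/6. *)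
Lemma card_derangements S : 1 < #|S| -> #|S|`! <= 3 * #|derangements S|.
Proof.
move=> S_gt1.
have: \sum_(s | perm_on S s) (1 + 'C(#|fixpts S s|, 2)) <=
      \sum_(s | perm_on S s) ((#|fixpts S s| == 0) + 'C(#|fixpts S s|, 1)
                               + 'C(#|fixpts S s|, 3)).
  by apply: leq_sum => s _; rewrite bin1 bin2_le_bin3.
rewrite !big_split /= !sum_bin_fixpts sum1_card card_perm.
have -> : \sum_(s | perm_on S s) (#|fixpts S s| == 0 : nat) = #|derangements S|.
  rewrite -sum1_card big_mkcond [RHS]big_mkcond; apply: eq_bigr => s _ /=.
  rewrite inE cards_eq0; case: (perm_on S s) => //=.
  have -> : (fixpts S s == set0) = [forall x in S, s x != x]; last by case: ifP.
  apply/eqP/forall_inP => [F0 x xS|H].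
    by apply/negP => fx; have := in_set0 x; rewrite -F0 inE xS fx.
  by apply/setP => x; rewrite !inE; apply/negP => /andP[/H/negP].
have b1 := @bin_fact #|S| 1; have b2 := @bin_fact #|S| 2; have b3 := @bin_fact #|S| 3.
have {b1}: 'C(#|S|, 1) * (#|S| - 1)`! = #|S|`! by rewrite -b1 ?mul1n //; lia.
have {b2}: 2 * ('C(#|S|, 2) * (#|S| - 2)`!) = #|S|`! by rewrite -b2 // mulnCA.
have {b3}: 6 * ('C(#|S|, 3) * (#|S| - 3)`!) <= #|S|`!.
  by case: (leqP 3 #|S|) => [/b3 <-|?]; [rewrite mulnCA | rewrite bin_small].
move: (_ * (#|S| - 3)`!) (_ * (#|S| - 2)`!) (_ * (#|S| - 1)`!) #|S|`! => x y z t.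
move: #|derangements S| => d H1 H2 H3 H4; lia.
Qed.

End Derangements.

(** * Thin vertices, their successor map, and tails *)

Section Digraph.
Variable T : finType.
Implicit Types (E : digraph T) (x y v : T).

Definition thin E x := (indeg E x == 1) && (outdeg E x == 1).

(** Non-thin vertices are made fixed points, so an orbit stays at the first non-thin vertex it
    meets. *)
Definition succ E x := if thin E x then odflt x [pick y | (x, y) \in E] else x.

(** Empty when there are no isolated cycles. After a rewiring of such a digraph it is exactly the
    vertex set of the tail, which is how the tail is recovered. *)
Definition trap E := [set x | [forall y, fconnect (succ E) x y ==> thin E y]].

Definition ends E := [set x | thin E x && ~~ thin E (succ E x)].

Lemma thin_out E x y : thin E x -> ((x, y) \in E) = (y == succ E x).
Proof.
move=> tx; rewrite /succ tx; move/andP: tx => [_ /cards1P[z Ez]].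
have H u : ((x, u) \in E) = (u == z) by rewrite -in_set1 -Ez inE.
by case: pickP => [u|/(_ z)]; rewrite H ?eqxx // => /eqP ->.
Qed.

Lemma thin_in E x y z : thin E z -> (x, z) \in E -> (y, z) \in E -> x = y.
Proof.
case/andP=> /cards1P[u Eu] _ xz yz.
have H w : ((w, z) \in E) = (w == u) by rewrite -in_set1 -Eu inE.
by move: xz yz; rewrite !H => /eqP-> /eqP->.
Qed.

Lemma arc_succ E x : thin E x -> (x, succ E x) \in E.
Proof. by move=> tx; rewrite thin_out. Qed.

Lemma trapPn E x : reflect (exists k, ~~ thin E (iter k (succ E) x)) (x \notin trap E).
Proof.
rewrite inE; apply: (iffP forallPn) => [[y]|[k nt]].
  by rewrite negb_imply => /andP[/iter_findex <- nt]; exists (findex (succ E) x y).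
by exists (iter k (succ E) x); rewrite negb_imply fconnect_iter.
Qed.

Lemma trap_thin E x : x \in trap E -> thin E x.
Proof. by rewrite inE => /forallP/(_ x)/implyP; apply. Qed.

Lemma trap_succ E x : x \in trap E -> succ E x \in trap E.
Proof.
apply: contraTT => /trapPn[k nt]; apply/trapPn; exists k.+1.
by rewrite iterSr.
Qed.

(** The common successor lies in the trap, so it is thin and has a single in-neighbour. *)
Lemma succ_trap_inj E : {in trap E &, injective (succ E)}.
Proof.
move=> x y tx ty exy; have tsx := trap_thin (trap_succ tx).
apply: (thin_in tsx); first exact/arc_succ/trap_thin.
by rewrite exy; exact/arc_succ/trap_thin.
Qed.

(* On the trap the successor map is a permutation, and its orbits are isolated
   cycles. *)
Lemma trap_eq0 E :
  simple_digraph E -> ~~ [exists C, isolated_cycle E C] -> trap E = set0.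
Proof.
move=> /forallP sE noC; apply/setP => x; rewrite in_set0.
apply/negP => tx; case/negP: noC; apply/existsP.
pose p := fingraph.orbit (succ E) x; exists [set y in p].
have Up : uniq p by exact: orbit_uniq.
have Cp : fcycle (succ E) p.
  by apply: (cycle_orbit_in _ _ tx); [exact: trap_succ | exact: succ_trap_inj].
have pt y : y \in p -> thin E y.
  by rewrite -fconnect_orbit; move: tx; rewrite inE => /forallP/(_ y)/implyP.
have xp : x \in p by rewrite -fconnect_orbit connect0.
have nextp y : y \in p -> next p y = succ E y by move=> yp; exact: nextE.
have outp y z : y \in p -> (y, z) \in E -> z = next p y.
  by move=> yp; rewrite thin_out ?pt // nextp // => /eqP.
have inp y z : y \in p -> (z, y) \in E -> z = prev p y.
  move=> yp zy; apply: (thin_in (pt _ yp) zy).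
  have pyp : prev p y \in p by rewrite mem_prev.
  by rewrite -[in X in (_, X)](next_prev Up y) nextp // arc_succ // pt.
have cp : #|[set y in p]| = size p by rewrite cardsE; exact/card_uniqP.
apply/andP; split; first apply/andP; first split.
- have nx : succ E x != x.
    by apply: contraNneq (sE x) => e; rewrite -{2}e arc_succ // pt.
  have sx : succ E x \in p by rewrite -nextp // mem_next.
  rewrite cp ltnNge; apply: contra nx.
  by move: sx xp; case: (p) => [|a [|b q]] //; rewrite !inE => /eqP -> /eqP ->.
- have sp : size p == #|[set y in p]| by rewrite cp.
  apply/existsP; exists (Tuple sp) => /=; rewrite Up eqxx /=.
  apply/eqP/setP => -[y z]; apply/idP/imsetP => [|[u]].
    by rewrite !inE /= => /and3P[yz yp zp]; exists y; rewrite ?inE // (outp y z).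
  rewrite inE => up [-> ->]; rewrite !inE /= mem_next up andbT andbT.
  by rewrite nextp // arc_succ ?pt.
- apply/forall_inP => y; rewrite inE => yp; apply/forall_inP => z.
  rewrite !inE => zp; apply/andP; split; apply: contra zp.
    by move/(outp _ _ yp) ->; rewrite mem_next.
  by move/(inp _ _ yp) ->; rewrite mem_prev.
Qed.

(** Both [v] and the first non-thin vertex are left out. A trajectory of [#|T|] vertices is long
    enough to meet a non-thin one when the trap is empty. *)
Definition tail E v :=
  let t := traject (succ E) (succ E v) #|T| in take (find (predC (thin E)) t) t.

Lemma tail_thin E v : all (thin E) (tail E v).
Proof.
rewrite /tail; set t := traject _ _ _; apply/(all_nthP v) => i.
rewrite size_take => lti.
have lt_f : i < find (predC (thin E)) t by move: lti; case: ifP => // *; lia.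
by rewrite nth_take //; have := before_find v lt_f => /= /negbFE.
Qed.

Lemma tail_path E v : fpath (succ E) v (tail E v).
Proof.
rewrite /tail take_traject ?fpath_traject //.
by apply: leq_trans (find_size _ _) _; rewrite size_traject.
Qed.

Lemma tail_last E v : trap E = set0 -> thin E v ->
  ~~ thin E (succ E (last v (tail E v))).
Proof.
move=> t0 tv; rewrite /tail; set t := traject _ _ _.
have has_t : has (predC (thin E)) t.
  have /trapPn[k] : succ E v \notin trap E by rewrite t0 in_set0.
  set y := iter _ _ _ => ny; have cy : fconnect (succ E) (succ E v) y by exact: fconnect_iter.
  apply/hasP; exists y => //; apply/trajectP; exists (findex (succ E) (succ E v) y).
    exact: leq_trans (findex_max cy) (max_card _).
  by rewrite iter_findex.
have := nth_find (succ E v) has_t; set j := find _ _ => /=.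
have ltj : j < #|T| by move: has_t; rewrite has_find size_traject.
rewrite /t (nth_traject _ ltj) (take_traject _ _ (ltnW ltj)).
by rewrite last_traject -iterS iterSr.
Qed.

(** A repeated vertex would keep the trajectory of [v] among thin vertices for ever, whereas it
    reaches a non-thin one. *)
Lemma tail_uniq E v : trap E = set0 -> thin E v -> uniq (v :: tail E v).
Proof.
move=> t0 tv; have nlast := tail_last t0 tv; have := tail_thin E v.
move: nlast; have := tail_path E v => /fpathP[k ->]; rewrite last_traject.
rewrite -iterS => nk /allP thk; rewrite -trajectS looping_uniq.
apply/negP => lk.
have th i : thin E (iter i (succ E) v).
  have /loopingP/(_ i)/trajectP[j ltj ->] := lk; case: j ltj => [//|j ltj].
  by apply/thk/trajectP; exists j; rewrite ?iterSr //; lia.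
by rewrite th in nk.
Qed.

End Digraph.

(** * Turning a tail into isolated cycles *)

Section Rewire.
Variable T : finType.
Implicit Types (E : digraph T) (x y v : T) (s : seq T) (t : {perm T}).

(* [v] is sent directly to the end of its path, and the vertices of [s] are
   permuted by [t]. Sources of arcs are permuted among thin vertices, which is
   why all degrees are preserved. *)
Definition rewire E v s t : digraph T := [set a | (prev (v :: s) (t a.1), a.2) \in E].

Variables (E : digraph T) (v : T) (s : seq T) (t : {perm T}).
Hypotheses (Uvs : uniq (v :: s)) (thin_vs : all (thin E) (v :: s)).
Hypothesis path_s : fpath (succ E) v s.
Hypothesis end_s : ~~ thin E (succ E (last v s)).
Hypothesis der_t : t \in derangements [set x in s].

Let E' := rewire E v s t.

Let thin_s x : x \in v :: s -> thin E x.
Proof. exact/allP. Qed.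

Let t_out x : x \notin s -> t x = x.
Proof.
by move=> xs; rewrite (derangement_out der_t) ?inE.
Qed.

Let t_in x : (t x \in s) = (x \in s).
Proof.
move: der_t; rewrite inE => /andP[/perm_closed-/(_ x)]; by rewrite !inE.
Qed.

Let t_mem x : (t x \in v :: s) = (x \in v :: s).
Proof.
rewrite !inE t_in; case xs: (x \in s); first by rewrite !orbT.
by rewrite t_out ?xs.
Qed.

Let v_notin : v \notin s. Proof. by case/andP: Uvs. Qed.

Let prev_inj : injective (fun x => prev (v :: s) (t x)).
Proof. exact: inj_comp (can_inj (next_prev Uvs)) (@perm_inj _ t). Qed.

Let prev_out x : x \notin v :: s -> prev (v :: s) (t x) = x.
Proof.
move=> xs; rewrite t_out; last by apply: contra xs; rewrite inE orbC => ->.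
by rewrite prev_nth (negbTE xs).
Qed.

Let succ_prev y : y \in s -> succ E (prev (v :: s) y) = y.
Proof.
move=> ys; rewrite prev_nth inE ys orbT.
have /(pathP v)/(_ (index y s)) := path_s.
by rewrite index_mem ys nth_index // => /(_ isT)/eqP.
Qed.

Let prev_head : prev (v :: s) v = last v s.
Proof. by rewrite prev_nth mem_head memNindex // nth_last. Qed.

(** Sources are relabelled by a bijection of all vertices, which matches the in-neighbours of [y] in
    the two digraphs. *)
Lemma indeg_rewire y : indeg E' y = indeg E y.
Proof.
rewrite /indeg -(card_preimset [set x | (x, y) \in E] prev_inj).
by apply: eq_card => x; rewrite !inE.
Qed.

Lemma outdeg_rewire x : outdeg E' x = outdeg E x.
Proof.
have -> : outdeg E' x = outdeg E (prev (v :: s) (t x)).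
  by apply: eq_card => y; rewrite !inE.
have [xs|/prev_out -> //] := boolP (x \in v :: s).
have ps : prev (v :: s) (t x) \in v :: s by rewrite mem_prev t_mem.
by have /andP[_ /eqP ->] := thin_s xs; have /andP[_ /eqP ->] := thin_s ps.
Qed.

Lemma thin_rewire x : thin E' x = thin E x.
Proof. by rewrite /thin indeg_rewire outdeg_rewire. Qed.

Lemma card_rewire : #|E'| = #|E|.
Proof.
have inj : injective (fun a : T * T => (prev (v :: s) (t a.1), a.2)).
  by move=> [a b] [c d] [/prev_inj -> ->].
by rewrite -(card_preimset E inj); apply: eq_card => a; rewrite !inE.
Qed.

Lemma succ_rewire x : thin E x -> succ E' x = succ E (prev (v :: s) (t x)).
Proof.
move=> tx; have tx' : thin E' x by rewrite thin_rewire.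
apply/esym/eqP; rewrite -(thin_out _ tx') inE; apply: arc_succ.
have [xs|/prev_out -> //] := boolP (x \in v :: s).
by apply: thin_s; rewrite mem_prev t_mem.
Qed.

Lemma succ_rewire_in x : x \in s -> succ E' x = t x.
Proof.
move=> xs; rewrite succ_rewire ?succ_prev ?t_in //.
by apply: thin_s; rewrite inE xs orbT.
Qed.

Lemma succ_rewire_head : succ E' v = succ E (last v s).
Proof. by rewrite succ_rewire ?t_out ?prev_head // thin_s // mem_head. Qed.

Lemma succ_rewire_out x : x \notin v :: s -> succ E' x = succ E x.
Proof.
move=> xs; have [tx|nx] := boolP (thin E x); first by rewrite succ_rewire ?prev_out.
by rewrite /succ thin_rewire (negbTE nx).
Qed.

Lemma head_ends_rewire : v \in ends E'.
Proof.
by rewrite inE !thin_rewire succ_rewire_head end_s andbT thin_s // mem_head.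
Qed.

(** A loop on [s] would be a fixed point of [t]; a loop at [v] is excluded because [v] is thin and
    its new successor is not. *)
Lemma simple_rewire : simple_digraph E -> simple_digraph E'.
Proof.
move=> /forallP sE; apply/forallP => x.
have [tx|nx] := boolP (thin E x); last first.
  rewrite inE prev_out ?sE //; apply: contra nx; exact: thin_s.
rewrite thin_out ?thin_rewire //.
have [xs|xs] := boolP (x \in s).
  rewrite succ_rewire_in // eq_sym; move: der_t; rewrite inE => /andP[_].
  by move/forall_inP => /(_ x); rewrite inE; apply.
have [xv|xv] := eqVneq x v.
  by rewrite {2}xv succ_rewire_head; apply: contraNneq end_s => <-.
have xvs : x \notin v :: s by rewrite inE negb_or xv.
by rewrite succ_rewire_out //; apply: contraNneq (sE x) => e; rewrite {2}e arc_succ.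
Qed.

(** The set [s] is closed under [t], hence trapped. Outside it, induction on the number of steps to
    a non-thin vertex in [E] shows that escape is still possible: [v] now escapes in one step. *)
Lemma trap_rewire : trap E = set0 -> trap E' = [set x in s].
Proof.
move=> t0; apply/setP => x; rewrite [RHS]inE; apply/idP/idP; last first.
  move=> xs; apply/negPn/trapPn => -[k]; rewrite thin_rewire.
  have: iter k (succ E') x \in s.
    by elim: k => //= k IH; rewrite succ_rewire_in // t_in.
  by move=> ks; rewrite thin_s // inE ks orbT.
apply: contraTT => xs; have /trapPn[k] : x \notin trap E by rewrite t0 in_set0.
elim: k x xs => [|k IH] x xs /= nk; first by apply/trapPn; exists 0; rewrite thin_rewire.
have [tx|nx] := boolP (thin E x); last by apply/trapPn; exists 0; rewrite thin_rewire.
have [xv|xv] := eqVneq x v.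
  by apply/trapPn; exists 1; rewrite /= thin_rewire xv succ_rewire_head.
have xvs : x \notin v :: s by rewrite inE negb_or xv.
(* A vertex of [s] is thin, and its only in-neighbour in [E] already lies on [v :: s]. *)
have ss : succ E x \notin s.
  apply/negP => ss; have ps : prev (v :: s) (succ E x) \in v :: s.
    by rewrite mem_prev inE ss orbT.
  case/negP: xvs; rewrite (@thin_in _ E x (prev (v :: s) (succ E x)) (succ E x)) //.
  - by apply: thin_s; rewrite inE ss orbT.
  - exact: arc_succ.
  by rewrite -[in X in (_, X)](succ_prev ss) arc_succ // thin_s.
have := IH _ ss; rewrite -iterSr => /(_ nk) /trapPn[j nj].
by apply/trapPn; exists j.+1; rewrite iterSr succ_rewire_out.
Qed.

Lemma rewireK : E = [set a | (t^-1 (next (v :: s) a.1), a.2) \in E']%g.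
Proof. by apply/setP => -[x y]; rewrite !inE permKV prev_next. Qed.

End Rewire.

(** The derangement is read off the image as its successor map on [s]; once it is known, rewiring
    can be undone. *)
Lemma rewire_inj (T : finType) (E1 E2 : digraph T) v s t1 t2 :
  let ok E t := [/\ uniq (v :: s), all (thin E) (v :: s), fpath (succ E) v s &
                    t \in derangements [set x in s]] in
  ok E1 t1 -> ok E2 t2 -> rewire E1 v s t1 = rewire E2 v s t2 -> E1 = E2.
Proof.
move=> ok [U1 th1 p1 d1] [U2 th2 p2 d2] eqE.
rewrite (rewireK E1 t1 U1) (rewireK E2 t2 U2) eqE; suff -> : t1 = t2 by [].
apply/permP => x; have [xs|xs] := boolP (x \in s).
  by rewrite -(succ_rewire_in U1 th1 p1 d1) // eqE succ_rewire_in.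
by rewrite (derangement_out d1) ?(derangement_out d2) ?inE.
Qed.

(** * Degree sums and weighted double counting *)

Section Counting.
Variable T : finType.
Implicit Types (E : digraph T) (v : T).

Lemma sum_outdeg E : \sum_x outdeg E x = #|E|.
Proof.
under eq_bigr => x _ do rewrite /outdeg -sum1dep_card.
by rewrite pair_big_dep /= -sum1_card; apply: eq_bigl => -[].
Qed.

Lemma sum_indeg E : \sum_x indeg E x = #|E|.
Proof.
rewrite -sum_outdeg.
under eq_bigr => x _ do rewrite /indeg -sum1dep_card big_mkcond.
rewrite exchange_big; apply: eq_bigr => x _ /=.
by rewrite -big_mkcond sum1dep_card.
Qed.

(** The arcs into thin vertices, one for each, and the arcs leaving [ends E], which go to non-thin
    vertices, are all distinct. *)
Lemma card_ends E : #|ends E| + #|[set x | thin E x]| <= #|E|.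
Proof.
rewrite -(sum_indeg E) (bigID (thin E)) /= addnC leq_add //.
  by rewrite -sum1dep_card; apply: leq_sum => x /andP[/eqP-> _].
have -> : \sum_(y | ~~ thin E y) indeg E y =
          \sum_(y | ~~ thin E y) \sum_x ((x, y) \in E : nat).
  by apply: eq_bigr => y _; rewrite /indeg -sum1dep_card big_mkcond.
rewrite exchange_big /= -sum1_card big_mkcond; apply: leq_sum => x _.
rewrite inE; case: ifP => // /andP[tx ns].
by rewrite (bigD1 (succ E x)) //= arc_succ.
Qed.

(** Three thin vertices in a row give a tail of length at least 2, as the bound on derangements
    requires. *)
Definition good E :=
  [set v | [&& thin E v, thin E (succ E v) & thin E (succ E (succ E v))]].

(** A thin vertex that is not good is in [ends E] or precedes a member of it; [succ E] is injective
    on the latter kind, since thin vertices have in-degree 1. *)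
Lemma card_thin E : #|[set x | thin E x]| <= #|good E| + 2 * #|ends E|.
Proof.
pose B := [set x | thin E x && (succ E x \in ends E)].
have cB : #|B| <= #|ends E|.
  have inj : {in B &, injective (succ E)}.
    move=> x y; rewrite !inE => /and3P[tx tsx _] /and3P[ty _ _] e.
    by apply: (thin_in tsx); rewrite ?arc_succ // e arc_succ.
  rewrite -(card_in_imset inj); apply/subset_leq_card/subsetP => _ /imsetP[x + ->].
  by rewrite inE => /andP[].
have sub : [set x | thin E x] \subset good E :|: (ends E :|: B).
  apply/subsetP => x; rewrite !inE => tx; rewrite tx /=.
  by case: (thin E (succ E x)); case: (thin E (succ E (succ E x))).
have := subset_leq_card sub; have [+ _] := leq_card_setU (good E) (ends E :|: B).
have [+ _] := leq_card_setU (ends E) B; lia.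
Qed.

Lemma size_tail E v : trap E = set0 -> v \in good E -> 1 < size (tail E v).
Proof.
rewrite inE => t0 /and3P[tv tsv tssv]; have := tail_last t0 tv; have := tail_path E v.
case: (tail E v) => [|a [|b s]] //=; first by rewrite tsv.
by rewrite andbT => /eqP<-; rewrite tssv.
Qed.

(** Give each related pair the weight [a / f i]. The total is at least 1 at each [i], and at most
    [a * b] at each [j] because [f i = g j]. *)
Lemma double_count (I J : finType) (A : {set I}) (B : {set J}) (r : I -> J -> bool)
    (f : I -> nat) (g : J -> nat) (a b : nat) :
    (forall i j, r i j -> f i = g j) ->
    (forall i, i \in A -> 0 < f i <= a * #|[set j in B | r i j]|) ->
    (forall j, j \in B -> #|[set i in A | r i j]| <= b * g j) ->
  #|A| <= a * b * #|B|.
Proof.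
move=> fg outA inB; rewrite -(ler_nat rat) !natrM.
have e1 i : i \in A ->
    (1 <= \sum_(j in B) (if r i j then a%:R / (f i)%:R else 0 : rat))%R.
  move=> /outA/andP[f0 fa]; rewrite -big_mkcondr sumr_const -(mulr_natr (_ / _)) mulrAC.
  rewrite ler_pdivlMr ?ltr0n // mul1r -natrM ler_nat (leq_trans fa) //.
  by rewrite leq_mul // subset_leq_card //; apply/subsetP => j; rewrite inE.
have e2 j : j \in B ->
    (\sum_(i in A) (if r i j then a%:R / (f i)%:R else 0 : rat) <= a%:R * b%:R)%R.
  move=> /inB gb; rewrite -big_mkcondr.
  have -> : (\sum_(i in A | r i j) a%:R / (f i)%:R =
             \sum_(i in A | r i j) (a%:R / (g j)%:R : rat))%R.
    by apply: eq_bigr => i /andP[_ /fg ->].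
  rewrite sumr_const -(mulr_natr (_ / _)) -mulrA ler_wpM2l ?ler0n //.
  (* If [g j] vanishes, its inverse is 0 and the bound is trivial. *)
  have [->|g0] := posnP (g j); first by rewrite invr0 mul0r ler0n.
  rewrite mulrC ler_pdivrMr ?ltr0n // -natrM ler_nat (leq_trans _ gb) //.
  by rewrite subset_leq_card //; apply/subsetP => i; rewrite inE.
rewrite -sumr_const.
apply: (le_trans (ler_sum _ e1)); rewrite exchange_big /=.
by apply: (le_trans (ler_sum _ e2)); rewrite sumr_const -(mulr_natr (_ * _)).
Qed.

End Counting.

(** * The explicit inequality between the two counts *)

Section Bound.
Variables n1 n m : nat.
Hypothesis le_n1n : n1 <= n.
Hypothesis le_nm : n <= m.
Implicit Types (E : digraph 'I_n) (v : 'I_n).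

Lemma rewire_digraphs11 E v t :
    E \in digraphs11 n1 n m -> trap E = set0 -> thin E v ->
    t \in derangements [set x in tail E v] ->
  rewire E v (tail E v) t \in digraphs11 n1 n m.
Proof.
move=> + t0 tv dt; rewrite !inE => /and5P[sE /eqP cE in1 out1 out0].
have Us := tail_uniq t0 tv; have ths : all (thin E) (v :: tail E v) by rewrite /= tv tail_thin.
rewrite simple_rewire ?tail_path ?tail_last // card_rewire // cE eqxx /=.
apply/and3P; split; apply/forallP => i; rewrite ?indeg_rewire ?outdeg_rewire //;
  [exact: (forallP in1) | exact: (forallP out1) | exact: (forallP out0)].
Qed.

Lemma card_not_thin E :
  E \in digraphs11 n1 n m -> #|[set x | ~~ thin E x]| <= 2 * (m - n1).
Proof.
rewrite !inE => /and5P[_ /eqP cE /forallP in1 /forallP out1 /forallP out0].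
(* Once the vertices outside $[n_1]$ are credited 2, the two degrees add up to at least 2 at every
   vertex and at least 3 at a non-thin one. *)
have: \sum_(x < n) ((~~ thin E x) + 2) <=
      \sum_(x < n) (indeg E x + outdeg E x + 2 * (n1 <= x)).
  apply: leq_sum => x _; have := in1 x; have := out1 x; have := out0 x; rewrite /thin.
  by case: (ltnP x n1) => /= _; move: (indeg E x) (outdeg E x) => [|[|i]] [|[|o]] //=; lia.
rewrite !big_split /= sum_indeg sum_outdeg cE big1_eq sum_nat_const card_ord.
have -> : \sum_(x < n) (~~ thin E x) = #|[set x | ~~ thin E x]|.
  by rewrite -sum1dep_card [RHS]big_mkcond.
have -> : \sum_(x < n) (n1 <= x) = n - n1.
  rewrite -(big_mkord xpredT (fun x => n1 <= x : nat)) (big_cat_nat (leq0n n1) le_n1n) /=.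
  rewrite big_nat_cond big1 => [|i /andP[/andP[_ ?] _]]; last by rewrite leqNgt; case: ltnP; lia.
  rewrite add0n big_nat (eq_bigr (fun=> 1)) => [|i /andP[->]//].
  by rewrite -big_nat sum_nat_const_nat muln1.
by move: #|_| => q H; lia.
Qed.

Lemma card_ends11 E :
  E \in digraphs11 n1 n m -> #|ends E| <= (m - n) + 2 * (m - n1).
Proof.
move=> EB; have := card_not_thin EB; have := card_ends E.
have := cardsC [set x | thin E x]; rewrite card_ord.
have -> : ~: [set x | thin E x] = [set x | ~~ thin E x] by apply/setP => x; rewrite !inE.
by move: EB; rewrite inE => /and5P[_ /eqP -> _ _ _]; lia.
Qed.

Lemma card_good E :
  E \in digraphs11 n1 n m -> n <= #|good E| + 2 * (m - n) + 6 * (m - n1).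
Proof.
move=> EB; have := card_not_thin EB; have := card_ends11 EB; have := card_thin E.
have := cardsC [set x | thin E x]; rewrite card_ord.
have -> : ~: [set x | thin E x] = [set x | ~~ thin E x] by apply/setP => x; rewrite !inE.
lia.
Qed.

(** The factor is 3 k + 2 (m - n) + 6 (m - n1), where k bounds the size of [ends] and the other two
    terms pay for the vertices that are not good. *)
Lemma C011_le : n * C011 n1 n m <= (5 * (m - n) + 12 * (m - n1)) * C11 n1 n m.
Proof.
set k := (m - n) + 2 * (m - n1).
set B := digraphs11 n1 n m; pose A := [set E in B | ~~ [exists C, isolated_cycle E C]].
have A_B E : E \in A -> E \in B by rewrite inE => /andP[].
have A_trap E : E \in A -> trap E = set0.
  rewrite inE => /andP[+ nC]; rewrite inE => /andP[sE _]; exact: trap_eq0.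
pose P := [set p : digraph 'I_n * 'I_n | (p.1 \in A) && (p.2 \in good p.1)].
have cP : \sum_(E in A) #|good E| = #|P|.
  under eq_bigr do rewrite -sum1_card.
  by rewrite pair_big_dep /= -sum1dep_card.
pose s (p : digraph 'I_n * 'I_n) := tail p.1 p.2.
pose r p E' := (p \in P) &&
  [exists t in derangements [set x in s p], E' == rewire p.1 p.2 (s p) t].
have Pprop p : p \in P -> [/\ trap p.1 = set0, uniq (p.2 :: s p),
    all (thin p.1) (p.2 :: s p), fpath (succ p.1) p.2 (s p) &
    ~~ thin p.1 (succ p.1 (last p.2 (s p)))].
  rewrite inE => /andP[/A_trap t0 vg].
  have tv : thin p.1 p.2 by move: vg; rewrite inE => /andP[].
  by split; rewrite ?tail_uniq ?tail_path ?tail_last //= tv tail_thin.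
have cPB : #|P| <= 3 * k * #|B|.
  (* The weight is the factorial of the tail length, visible in the image as that of the trap size,
     so tails of all lengths are treated in one count. *)
  apply: (@double_count _ _ _ _ r (fun p => (size (s p))`!) (fun E' => #|trap E'|`!)).
  - move=> p E' /andP[/Pprop[t0 U th ps es] /exists_inP[t dt /eqP->]].
    rewrite trap_rewire // cardsE; congr _`!; apply/esym/card_uniqP.
    by case/andP: U.
  - move=> p pP; rewrite fact_gt0 /=; have [t0 U th ps es] := Pprop _ pP.
    have cs : #|[set x in s p]| = size (s p).
      by rewrite cardsE; apply/card_uniqP; case/andP: U.
    have [pA pg] : p.1 \in A /\ p.2 \in good p.1 by apply/andP; move: pP; rewrite inE.
    rewrite -cs (leq_trans (card_derangements _)) ?cs ?size_tail //.
    rewrite leq_mul2l /= -(card_in_imset (f := rewire p.1 p.2 (s p))).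
      apply/subset_leq_card/subsetP => _ /imsetP[t dt ->]; rewrite inE.
      rewrite rewire_digraphs11 ?A_B //=; last by case/andP: th.
      by rewrite /r pP; apply/exists_inP; exists t.
    move=> t1 t2 d1 d2 eqE; apply/permP => x; have [xs|xs] := boolP (x \in s p).
      by rewrite -(succ_rewire_in U th ps d1) // eqE (succ_rewire_in U th ps d2).
    by rewrite (derangement_out d1) ?(derangement_out d2) ?inE.
  move=> E' E'B; have /leq_trans -> // : #|[set p in P | r p E']| <=
      #|ends E'| * #|trap E'|`!; last by rewrite leq_mul2r card_ends11 ?orbT.
  (* Given the image [E'], a pair is determined by its vertex, which lies in [ends E'], and its tail
     as a sequence, which is an ordering of [trap E']. *)
  pose h (p : digraph 'I_n * 'I_n) := (p.2, s p).
  have inj : {in [set p in P | r p E'] &, injective h}.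
    move=> [E1 v1] [E2 v2]; rewrite inE => /and3P[/Pprop[_ U1 th1 p1 _] _].
    case/exists_inP=> t1 d1 /eqP e1; rewrite inE => /and3P[/Pprop[_ U2 th2 p2 _] _].
    case/exists_inP=> t2 d2 /eqP e2 [ev es].
    move: U1 th1 p1 d1 e1 U2 th2 p2 d2 e2; rewrite /= es -ev.
    move=> U1 th1 p1 d1 e1 U2 th2 p2 d2 e2.
    by congr (_, _); apply: (@rewire_inj _ _ _ v1 (s (E2, v1)) t1 t2); rewrite -?e1 -?e2.
  have := @uniq_leq_size _ (map h (enum [set p in P | r p E']))
    [seq (v, q) | v <- enum (ends E'), q <- permutations (enum (trap E'))].
  rewrite size_map size_allpairs size_permutations ?enum_uniq // -!cardE; apply.
    by rewrite map_inj_in_uniq ?enum_uniq // => p q; rewrite !mem_enum; exact: inj.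
  move=> _ /mapP[p + ->]; rewrite mem_enum inE => /and3P[/Pprop[t0 U th ps es] _].
  case/exists_inP=> t dt /eqP ->; apply/allpairsP; exists (h p); split=> //.
    by rewrite mem_enum head_ends_rewire.
  rewrite mem_permutations trap_rewire //; apply: uniq_perm.
  - by case/andP: U.
  - exact: enum_uniq.
  by move=> x; rewrite mem_enum inE.
(* Sum over [A] the bound on the number of vertices that are not good. *)
have : n * #|A| <= #|P| + (2 * (m - n) + 6 * (m - n1)) * #|A|.
  rewrite -cP mulnC -sum_nat_const [X in _ + X]mulnC -sum_nat_const -big_split /=.
  by apply: leq_sum => E /A_B/card_good; rewrite addnA.
have cAB : #|A| <= #|B| by apply/subset_leq_card/subsetP => E; exact: A_B.
move=> H; apply: (leq_trans H); move: cPB; rewrite /C11 -/B /k; nia.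
Qed.

End Bound.

(** * The asymptotic form *)

Local Open Scope ring_scope.

Theorem theorem2p1 (R : realType) (c a b : R) (hc : 0 < c) :
  exists K r0 : R, forall n1 n m : nat,
    let r : R := m%:R - n%:R in
    let r1 : R := m%:R - n1%:R in
    (0 < n1)%N -> (n1 <= n)%N -> (0 < m)%N ->
    c * n%:R <= n1%:R ->
    r0 <= r ->
    m%:R <= a * n%:R ->
    r1 <= b * r ->
    (C011 n1 n m)%:R <= K * (r / n%:R * (C11 n1 n m)%:R).
Proof.
(* From [r1 <= b * r] follows 5 r + 12 r1 <= (5 + 12 b) r, and [r0 = 0] already gives [n <= m]. *)
exists (5 + 12 * b), 0 => n1 n m r r1 n1_gt0 le_n1n _ _ r_ge0 _ r1_le.
have le_nm : (n <= m)%N by rewrite -(ler_nat R) -subr_ge0.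
have n_gt0 : 0 < n%:R :> R by rewrite ltr0n; lia.
rewrite [r / _ * _]mulrAC !mulrA ler_pdivlMr // mulrC -natrM.
have := C011_le le_n1n le_nm; rewrite -(ler_nat R) => /le_trans; apply.
rewrite natrM ler_wpM2r ?ler0n //.
rewrite natrD !natrM !natrB //; last exact: leq_trans le_nm.
by rewrite -/r -/r1; lra.
Qed.
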